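(* Let $G=(H,\sigma)$ be an oriented hypergraph with vertices $v_1,\dots,v_n$. Then $$\lambda_n(A(G))\le \frac{1}{n}\sum_{j=1}^n \mathrm{NumAdj}^{\pm}(v_j)\le \lambda_1(A(G)).$$
   Context: An oriented hypergraph $G=(H,\sigma)$ consists of a finite hypergraph $H=(V,E,\mathcal{I})$ with vertex set $V=\{v_1,\dots,v_n\}$, a finite set $E$ of edges, each edge a (possibly empty) subset of $V$, and incidence set $\mathcal{I}$, together with an incidence orientation $\sigma:\mathcal{I}\to\{+1,-1\}$. Throughout, hypergraphs are simple: $(v,e)\in\mathcal{I}$ if and only if $v\in e$, each such pair occurring once. The set of adjacencies is $\mathcal{A}=\{(e,\{v_i,v_j\}): e\in E,\ v_i\neq v_j,\ v_i,v_j\in e\}$, and the sign of an adjacency is $\mathrm{sgn}_e(v_i,v_j)=-\sigma(v_i,e)\sigma(v_j,e)$. For a vertex $v$, $\mathrm{NumAdj}^{+}(v)$ (resp. $\mathrm{NumAdj}^{-}(v)$) is the number of adjacencies $(e,\{v,w\})\in\mathcal{A}$ with $\mathrm{sgn}_e(v,w)=+1$ (resp. $-1$), and $\mathrm{NumAdj}^{\pm}(v)=\mathrm{NumAdj}^{+}(v)-\mathrm{NumAdj}^{-}(v)$. The adjacency matrix $A(G)=(a_{ij})$ is the $n\times n$ matrix with $a_{ij}=\sum_{e\in E:\, v_i,v_j\in e}\mathrm{sgn}_e(v_i,v_j)$ for $i\neq j$, and $a_{ii}=0$. Eigenvalues of a real symmetric $n\times n$ matrix $M$ are ordered $\lambda_n(M)\le\cdots\le\lambda_1(M)$.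 *)

(* Defs.v *)
From HB Require Import structures.
From mathcomp Require Import all_boot all_order all_algebra.
From mathcomp Require Import reals.
From mathcomp Require Import polyrcf.

Set Implicit Arguments.
Unset Strict Implicit.
Unset Printing Implicit Defensive.

Import Order.TTheory GRing.Theory Num.Theory.

Local Open Scope ring_scope.

(* The vertices v_1, ..., v_n are the elements of 'I_n (so v_i has value      *)
(* i - 1).  Edges are subsets of the vertex set, so there are no repeated     *)
(* edges, but the empty edge and singleton edges are allowed.                 *)
(* Simplicity makes the incidence set a function of the edge set.             *)
Definition incidences (n : nat) (E : {set {set 'I_n}}) :
    {set 'I_n * {set 'I_n}} :=
  [set ve | (ve.2 \in E) && (ve.1 \in ve.2)].

(* orient is total for convenience; only its values on incidences are         *)
(* constrained, and only those are used below.                                *)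
Record oriented_hypergraph (n : nat) := OrientedHypergraph {
  edges : {set {set 'I_n}};
  orient : 'I_n -> {set 'I_n} -> int;
  orientP : forall v e, (v, e) \in incidences edges ->
              orient v e = 1 \/ orient v e = -1 }.

Section Adjacency.
Variables (n : nat) (G : oriented_hypergraph n).

Definition adjacencies : {set {set 'I_n} * {set 'I_n}} :=
  [set a | (a.1 \in edges G) &&
     [exists v, exists w,
        [&& v != w, v \in a.1, w \in a.1 & a.2 == [set v; w]]]].

Definition adj_sign (e : {set 'I_n}) (v w : 'I_n) : int :=
  - (orient G v e * orient G w e).

Definition num_adj (s : int) (v : 'I_n) : nat :=
  #|[set a in adjacencies |
       [exists w, (a.2 == [set v; w]) && (adj_sign a.1 v w == s)]]|.

Definition num_adj_pos (v : 'I_n) : nat := num_adj 1 v.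
Definition num_adj_neg (v : 'I_n) : nat := num_adj (-1) v.
Definition num_adj_pm (v : 'I_n) : int :=
  (num_adj_pos v)%:Z - (num_adj_neg v)%:Z.

Definition adj_mx (R : pzRingType) : 'M[R]_n :=
  \matrix_(i, j)
    if i == j then 0
    else \sum_(e in edges G | (i \in e) && (j \in e)) (adj_sign e i j)%:~R.

End Adjacency.

(* The real roots of the characteristic polynomial, repeated according to     *)
(* multiplicity and listed in nonincreasing order.  For a symmetric matrix    *)
(* all the roots are real, so this list has n terms.                          *)
Definition eigenvalues (R : rcfType) (n : nat) (M : 'M[R]_n) : seq R :=
  sort >=%R (flatten [seq nseq (mup x (char_poly M)) x
                         | x <- rootsR (char_poly M)]).

(* lambda_k(M), with k counted from 1; the default value 0 is not reached     *)
(* when M is symmetric and 1 <= k <= n.                                       *)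
Definition lambda (R : rcfType) (n : nat) (k : nat) (M : 'M[R]_n) : R :=
  (eigenvalues M)`_k.-1.

(* Main.v *)
(* The average of the NumAdj^pm(v_j) is the Rayleigh quotient of A(G) at the   *)
(* all-ones vector, since the j-th row of A(G) sums to NumAdj^pm(v_j).  A      *)
(* Rayleigh quotient of a symmetric real matrix is a convex combination of     *)
(* its eigenvalues: this is read off the unitary diagonalization over R[i],    *)
(* whose eigenvalues are real.                                                 *)
Require Import Defs.
From mathcomp Require Import all_boot all_order all_algebra.
From mathcomp Require Import reals.
From mathcomp Require Import spectral sesquilinear polyrcf complex.

Set Implicit Arguments.
Unset Strict Implicit.
Unset Printing Implicit Defensive.

Import Order.TTheory GRing.Theory Num.Theory.

Local Open Scope ring_scope.
Local Open Scope sesquilinear_scope.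

(** At the all-ones vector $v$ one has $v v^T = n$, while $v A v^T$ adds up the row sums of $A$,
    computed in [row_sum_adj_mx]; dividing [rayleigh_bounds] by $n$ gives both inequalities. That
    bound combines [symmetric_spectral], which writes $v M v^T$ as $\sum_i d_i w_i$ with weights
    $w_i \ge 0$ of total $v v^T$, with [lambda_bounds], which places every $d_i$ between the extreme
    entries of [eigenvalues M]. The row sums rest on [num_adjE], where adjacencies at $v$ are
    counted as pairs of a second vertex and an edge. *)

Lemma mup_prod_XsubC (R : fieldType) (s : seq R) (x : R) :
  mup x (\prod_(a <- s) ('X - a%:P)) = count_mem x s.
Proof.
elim: s => [|a s IHs] /=.
  by rewrite big_nil mupNroot // root1.
rewrite big_cons mupM ?polyXsubC_eq0 //; last first.
  exact/monic_neq0/monic_prod_XsubC.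
by rewrite IHs -['X - _]expr1 mup_XsubCX eq_sym; case: eqP.
Qed.

Lemma count_flatten_nseq (T : eqType) (m : T -> nat) (s : seq T) (x : T) :
  uniq s ->
  count_mem x (flatten [seq nseq (m y) y | y <- s]) = (m x * (x \in s))%N.
Proof.
elim: s => [|y s IHs] /=; first by rewrite muln0.
case/andP=> ys us; rewrite count_cat IHs // count_nseq in_cons /= [y == x]eq_sym.
case: eqP => [->|_]; last by rewrite mul0n.
by rewrite (negPf ys) mul1n muln0 addn0 muln1.
Qed.

(** Both lists contain each $x$ as often as its multiplicity as a root of the characteristic
    polynomial. This lets any splitting into linear factors stand in for the sorted list of
    roots. *)
Lemma eigenvalues_perm (R : rcfType) (n : nat) (M : 'M[R]_n) (s : seq R) :
  char_poly M = \prod_(a <- s) ('X - a%:P) -> perm_eq (eigenvalues M) s.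
Proof.
move=> charM; have charM0 : char_poly M != 0 by exact/monic_neq0/char_poly_monic.
rewrite /eigenvalues perm_sort; apply/allP => x _ /=.
rewrite count_flatten_nseq ?uniq_roots //.
suff -> : (x \in rootsR (char_poly M)) = root (char_poly M) x.
  have [rx|nrx] := boolP (root _ x); first by rewrite muln1 charM mup_prod_XsubC.
  by rewrite muln0 -mup_prod_XsubC -charM mupNroot.
by have := roots_on_rootsR charM0 x; rewrite inE /= => <-.
Qed.

Lemma char_poly_conj (F : fieldType) (n : nat) (P D : 'M[F]_n) :
  P \in unitmx -> char_poly (invmx P *m D *m P) = char_poly D.
Proof.
move=> Pu; rewrite /char_poly /char_poly_mx !map_mxM.
set p := map_mx _ P; set q := map_mx _ (invmx P).
have qp : q *m p = 1%:M by rewrite -map_mxM mulVmx // map_mx1.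
have -> : 'X%:M - q *m map_mx polyC D *m p = q *m ('X%:M - map_mx polyC D) *m p.
  by rewrite mulmxBr mulmxBl scalar_mxC -[_ *m q *m p]mulmxA qp mulmx1.
by rewrite !det_mulmx mulrAC -det_mulmx qp det1 mul1r.
Qed.

(** The $w_i$ are the squared moduli of the coordinates of $v$ in a unitary eigenbasis over [R[i]]:
    unitarity gives their total, diagonalization the quadratic form. Since [d] and [w] take values
    in [R], complex numbers stay inside this proof. *)
Lemma symmetric_spectral (R : rcfType) (n : nat) (M : 'M[R]_n) : M^T = M ->
  exists2 d : 'I_n -> R, char_poly M = \prod_i ('X - (d i)%:P) &
    forall v : 'rV[R]_n, exists w : 'I_n -> R,
      [/\ forall i, 0 <= w i, \sum_i w i = (v *m v^T) 0 0
        & \sum_i d i * w i = (v *m M *m v^T) 0 0].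
Proof.
move=> symM; pose c := real_complex R; pose A := map_mx c M.
have c_real k : c k \is Num.real by apply/complex_realP; exists k.
have Aherm : A \is hermsymmx.
  apply: realsym_hermsym.
    apply/is_hermitianmxP; rewrite expr0 scale1r map_mx_id //.
    by rewrite map_trmx symM.
  by apply/mxOverP => i j; rewrite mxE.
have := orthomx_spectralP (hermitian_normalmx Aherm).
have := hermitian_spectral_diag_real Aherm.
have := spectral_unitarymx A.
move: (spectralmx A) (spectral_diag A) => P D Pu Dreal AE.
have DE i : c (complex.Re (D 0 i)) = D 0 i by apply/RRe_real/mxOverP.
exists (fun i => complex.Re (D 0 i)).
  (* The factorization is checked over [R[i]], where [A] is similar to the diagonal matrix of [D];
     by [DE], taking real parts of [D] loses nothing. *)
  apply: (map_poly_inj (real_complex R)).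
  rewrite map_char_poly -/A AE char_poly_conj ?unitarymx_unit //.
  rewrite char_poly_trig ?diag_mx_is_trig // rmorph_prod.
  apply: eq_bigr => i _; rewrite /= rmorphB /= map_polyX map_polyC /= -/(c _) DE.
  by rewrite mxE eqxx.
move=> v; pose u := map_mx c v *m P^t*.
have normE i : c (complex.Re (`|u 0 i| ^+ 2)) = `|u 0 i| ^+ 2.
  by apply: RRe_real; rewrite realX // normr_real.
(* Conjugation fixes the entries of [v], which are real. *)
have uE : P *m (map_mx c v)^T = u^t*.
  rewrite /u trmx_mul map_mxM trmxCK; congr (_ *m _).
  by apply/matrixP => i j; rewrite !mxE; exact/esym/CrealP/c_real.
exists (fun i => complex.Re (`|u 0 i| ^+ 2)); split.
- by move=> i; rewrite -ler0c [leRHS]normE exprn_ge0.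
- apply: (@complexI R).
  transitivity ((u *m u^t*) 0 0).
    rewrite rmorph_sum mxE; apply: eq_bigr => i _.
    by rewrite [LHS]normE normCK !mxE.
  by rewrite -uE /u mulmxA mulmxKtV // map_trmx -map_mxM mxE.
- apply: (@complexI R).
  transitivity ((u *m diag_mx D *m u^t*) 0 0).
    rewrite rmorph_sum mxE; apply: eq_bigr => i _.
    rewrite rmorphM [X in _ * X]normE [X in X * _]DE normCK mul_mx_diag !mxE.
    by rewrite mulrA [D _ _ * _]mulrC.
  transitivity ((map_mx c v *m A *m (map_mx c v)^T) 0 0).
    by rewrite AE invmx_unitary // -uE /u !mulmxA.
  by rewrite map_trmx -!map_mxM mxE.
Qed.

Lemma lambda_bounds (R : rcfType) (n : nat) (M : 'M[R]_n) (d : 'I_n -> R) :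
  char_poly M = \prod_i ('X - (d i)%:P) ->
  forall i, lambda n M <= d i <= lambda 1 M.
Proof.
move=> charM i.
have perm_d : perm_eq (eigenvalues M) [seq d j | j <- enum 'I_n].
  by apply: eigenvalues_perm; rewrite big_map big_enum.
have size_ev : size (eigenvalues M) = n.
  by rewrite (perm_size perm_d) size_map size_enum_ord.
have ev_sorted : sorted >=%R (eigenvalues M).
  by apply: sort_sorted => x y; exact: le_total.
have le_nth := sorted_leq_nth (@ge_trans _ R) (@ge_refl _ R) 0 ev_sorted.
have : d i \in eigenvalues M by rewrite (perm_mem perm_d) map_f ?mem_enum.
case/(nthP 0) => k; rewrite size_ev => kn <-.
(* The index [k] of [d i] already forces $n > 0$, so [n.-1] is the last valid index and the default
   of [nth] is not reached. *)
have n0 : (0 < n)%N by exact: leq_ltn_trans kn.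
rewrite /lambda; apply/andP; split.
  apply: le_nth; rewrite ?inE ?size_ev ?ltn_predL //.
  by rewrite -ltnS prednK.
by apply: le_nth; rewrite ?inE ?size_ev.
Qed.

Lemma rayleigh_bounds (R : rcfType) (n : nat) (M : 'M[R]_n) (v : 'rV[R]_n) :
  M^T = M ->
  lambda n M * (v *m v^T) 0 0 <= (v *m M *m v^T) 0 0
    <= lambda 1 M * (v *m v^T) 0 0.
Proof.
case/symmetric_spectral => d /lambda_bounds ld /(_ v)[w [w0 <- <-]].
rewrite !mulr_sumr; apply/andP.
split; apply: ler_sum => i _; have /andP[lo hi] := ld i.
  exact: ler_wpM2r.
exact: ler_wpM2r.
Qed.

(** The map [f] sends $(w,e)$ to the adjacency $(e,\{v,w\})$. It is injective on [B], since $w$ is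
    the element of $\{v,w\}$ other than $v$, and its image is the set being counted. *)
Lemma num_adjE (n : nat) (G : oriented_hypergraph n) (s : int) (v : 'I_n) :
  num_adj G s v = (\sum_(w | v != w)
    \sum_(e in edges G | (v \in e) && (w \in e)) (adj_sign G e v w == s))%N.
Proof.
pose f (p : 'I_n * {set 'I_n}) := (p.2, [set v; p.1]).
pose B := [set p : 'I_n * {set 'I_n} | (v != p.1) &&
  [&& p.2 \in edges G, (v \in p.2) && (p.1 \in p.2) & adj_sign G p.2 v p.1 == s]].
have -> : num_adj G s v = #|B|.
  have set2_inj w w' : v != w -> v != w' -> [set v; w] = [set v; w'] -> w = w'.
    move=> vw vw' /setP/(_ w); rewrite !inE eqxx orbT eq_sym (negPf vw) /=.
    by move/esym/eqP.
  rewrite -(@card_in_imset _ _ f B); last first.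
    case=> [w e] [w' e']; rewrite !inE /= => /andP[vw _] /andP[vw' _] [-> E].
    by rewrite (set2_inj w w').
  apply: eq_card => -[e a]; rewrite !inE /=; apply/idP/imsetP.
    case/andP=> /andP[eG /existsP[x /existsP[y /and4P[xy xe ye /eqP axy]]]].
    case/existsP=> w /andP[/eqP aw sgn].
    (* If $w = v$, the set $\{x,y\}$ would be the singleton $\{v\}$, against $x \neq y$. *)
    have vw : v != w.
      apply: contraNneq xy => vw; move: (axy); rewrite aw vw setUid.
      move/setP => E; have := E x; have := E y; rewrite !inE !eqxx orbT /=.
      by move=> /eqP-> /eqP->.
    have sub z : z \in a -> z \in e by rewrite axy !inE => /orP[]/eqP->.
    exists (w, e); last by rewrite /f /= aw.
    by rewrite inE /= vw eG sgn !sub // aw !inE eqxx ?orbT.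
  case=> -[w e']; rewrite inE /= => /and4P[vw eG /andP[ve we] sgn] [-> ->].
  rewrite eG /=; apply/andP; split.
    by apply/existsP; exists v; apply/existsP; exists w; rewrite vw ve we eqxx.
  by apply/existsP; exists w; rewrite eqxx.
rewrite -sum1_card pair_big_dep /= big_mkcond [RHS]big_mkcond /=.
apply: eq_bigr => -[w e] _; rewrite inE /=.
by case: (v != w); case: (e \in _); case: (v \in e); case: (w \in e); case: eqP.
Qed.

(** By [orientP] each sign is $1$ or $-1$, so it equals the indicator of being $1$ minus the
    indicator of being $-1$. *)
Lemma num_adj_pmE (n : nat) (G : oriented_hypergraph n) (v : 'I_n) :
  num_adj_pm G v = \sum_(w | v != w)
    \sum_(e in edges G | (v \in e) && (w \in e)) adj_sign G e v w.
Proof.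
rewrite /num_adj_pm /num_adj_pos /num_adj_neg !num_adjE.
rewrite !(big_morph Posz PoszD (erefl _)) -sumrB; apply: eq_bigr => w _.
rewrite !(big_morph Posz PoszD (erefl _)) -sumrB.
apply: eq_bigr => e /and3P[eG ve we].
have := @orientP _ G v e; have := @orientP _ G w e.
rewrite !inE /= eG ve we /adj_sign => /(_ isT) Hw /(_ isT) Hv.
by case: Hw => ->; case: Hv => ->.
Qed.

Lemma row_sum_adj_mx (R : pzRingType) (n : nat)
    (G : oriented_hypergraph n) (v : 'I_n) :
  \sum_w adj_mx G R v w = (num_adj_pm G v)%:~R.
Proof.
rewrite num_adj_pmE (bigD1 v) //= mxE eqxx add0r rmorph_sum /=.
apply: eq_big => [w|w vw]; first by rewrite eq_sym.
by rewrite mxE eq_sym (negPf vw) rmorph_sum.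
Qed.

Lemma adj_mx_sym (R : pzRingType) (n : nat) (G : oriented_hypergraph n) :
  (adj_mx G R)^T = adj_mx G R.
Proof.
apply/matrixP => i j; rewrite !mxE eq_sym; case: eqP => // _.
apply: eq_big => [e|e _]; first by rewrite [(j \in e) && _]andbC.
by rewrite /adj_sign mulrC.
Qed.

Theorem theorem3p3 (R : realType) (n : nat) (n_gt0 : (0 < n)%N)
    (G : oriented_hypergraph n) :
  lambda n (adj_mx G R) <= n%:R^-1 * \sum_(j < n) (num_adj_pm G j)%:~R
    /\ n%:R^-1 * \sum_(j < n) (num_adj_pm G j)%:~R <= lambda 1 (adj_mx G R).
Proof.
pose v : 'rV[R]_n := const_mx 1.
have vv : (v *m v^T) 0 0 = n%:R.
  rewrite mxE (eq_bigr (fun=> 1)) => [|i _]; last by rewrite !mxE mulr1.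
  by rewrite sumr_const card_ord.
have vAv : (v *m adj_mx G R *m v^T) 0 0 = \sum_(j < n) (num_adj_pm G j)%:~R.
  (* Multiplying by the all-ones column replaces each row of the matrix by its sum. *)
  rewrite -mulmxA mxE; apply: eq_bigr => i _; rewrite -row_sum_adj_mx !mxE mul1r.
  by apply: eq_bigr => j _; rewrite !mxE mulr1.
have := rayleigh_bounds v (adj_mx_sym R G).
rewrite vv vAv => /andP[lo hi].
by rewrite mulrC ler_pdivlMr ?ler_pdivrMr ?ltr0n.
Qed.
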